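(* Let $\xi$ be a countable ordinal, $M$ an infinite subset of $\mathbb{N}$ and $\mathcal{L}$ a $\xi$-uniform family on $M$. Then for every infinite subset $L$ of $M$ we have $(\mathcal{L}_{*})^{\xi}_L=\{\emptyset\}$ and $s_L(\mathcal{L}_{*})=\xi+1$.
   Context: $\mathbb{N}=\{1,2,3,\dots\}$. For an infinite $M\subseteq\mathbb{N}$, $[M]^{<\omega}$ is the set of all finite subsets of $M$ and $[M]$ the set of all infinite subsets of $M$. For finite sets, $s<t$ means $\max s<\min t$ (vacuously true if one of them is empty). A family is hereditary if it contains every subset of each of its elements. Subsets of $\mathbb{N}$ are identified with their characteristic functions and the set of all subsets of $\mathbb{N}$ carries the topology of pointwise convergence; closed and cluster point refer to it. $\mathcal{L}_{*}$ is the (hereditary) family of all subsets of elements of $\mathcal{L}$; it is pointwise closed when $\mathcal{L}$ is uniform. Uniform families. Let $M\in[\mathbb{N}]$ and $\mathcal{L}\subseteq[M]^{<\omega}$. For $m\in M$ put $\mathcal{L}(m)=\{s\in[M]^{<\omega}:\{m\}\cup s\in\mathcal{L}\text{ and }\{m\}<s\}$. For countable ordinals $\xi$, ''$\mathcal{L}$ is $\xi$-uniform on $M$'' is defined recursively: (1) $\mathcal{L}$ is $0$-uniform on $M$ if $\mathcal{L}=\{\emptyset\}$; (2) if $\xi=\zeta+1$, $\mathcal{L}$ is $\xi$-uniform on $M$ if $\emptyset\notin\mathcal{L}$ and $\mathcal{L}(m)$ is $\zeta$-uniform on $M\cap(m,+\infty)$ for every $m\in M$; (3) if $\xi$ is a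 nonzero limit ordinal, $\mathcal{L}$ is $\xi$-uniform on $M$ if $\emptyset\notin\mathcal{L}$ and there is an increasing sequence $(\xi_m)_{m\in M}$ of ordinals smaller than $\xi$ with $\sup_m\xi_m=\xi$ such that $\mathcal{L}(m)$ is $\xi_m$-uniform on $M\cap(m,+\infty)$ for every $m\in M$. Strong Cantor–Bendixson index. For a hereditary and pointwise closed family $\mathcal{F}$ of finite subsets of $\mathbb{N}$ and $M\in[\mathbb{N}]$, write $\mathcal{F}[M]=\mathcal{F}\cap[M]^{<\omega}$, put $(\mathcal{F})^0_M=\mathcal{F}[M]$ and $$(\mathcal{F})^1_M=\{A\in\mathcal{F}[M]: A\text{ is a cluster point of }\mathcal{F}[A\cup L]\text{ for each }L\in[M]\};$$ $(\mathcal{F})^{\xi+1}_M=((\mathcal{F})^{\xi}_M)^1_M$; and $(\mathcal{F})^{\xi}_M=\bigcap_{\beta<\xi}(\mathcal{F})^{\beta}_M$ for limit $\xi$. The index $s_M(\mathcal{F})$ is the smallest countable ordinal $\xi$ with $(\mathcal{F})^{\xi}_M=\emptyset$. *)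

(* Defs.v *)
From HB Require Import structures.
From mathcomp Require Import all_boot all_order finmap.
From mathcomp Require Import all_classical.
From mathcomp Require Import topology cantor.
Set Implicit Arguments.
Unset Strict Implicit.
Unset Printing Implicit Defensive.
Import Order.TTheory.
Local Open Scope classical_set_scope.
Local Open Scope order_scope.

(** [omega1] is the first uncountable ordinal, as a well-ordered type whose
    elements are the countable ordinals.  It is the set of those points of a
    well-ordering of the (uncountable) type [set nat] that have only countably
    many predecessors.  The lemmas [omega1_wo], [omega1_countable_seg] and
    [omega1_uncountable] characterize it up to a unique isomorphism. *)

Definition wo_le : rel (set nat) :=
  sval (wochoice.well_ordering_principle (set nat)).

Lemma wo_leP : wochoice.well_order wo_le.
Proof. exact: svalP (wochoice.well_ordering_principle (set nat)). Qed.

Lemma wo_le_min (P : set (set nat)) : P !=set0 ->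
  exists2 x, P x & forall y, P y -> wo_le x y.
Proof.
move=> [x Px]; have [z [[zP zmin] _]] : exists! z, wochoice.minimum_of wo_le [pred x | `[<P x>]] z.
  by apply: wo_leP; exists x; rewrite inE.
exists z; first by move: zP; rewrite inE.
by move=> y Py; apply: zmin; rewrite inE.
Qed.

Lemma wo_le_total : total wo_le.
Proof.
move=> x y; have [|z zxy zmin] := @wo_le_min [set x; y]; first by exists x; left.
case: zxy zmin => -> zmin.
- by rewrite (zmin y) //; right.
- by rewrite orbC (zmin x) //; left.
Qed.

Lemma wo_le_refl : reflexive wo_le.
Proof. by move=> x; have := wo_le_total x x; rewrite orbb. Qed.

Lemma wo_le_anti : antisymmetric wo_le.
Proof.
move=> x y /andP[xy yx]; have [z [_ zu]] :
    exists! z, wochoice.minimum_of wo_le [pred t | `[<t = x \/ t = y>]] z.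
  by apply: wo_leP; exists x; rewrite inE; left.
rewrite -(zu x); last first.
  split; first by rewrite inE; left.
  by move=> t; rewrite inE => -[->|->]//; exact: wo_le_refl.
apply: zu; split; first by rewrite inE; right.
by move=> t; rewrite inE => -[->|->]//; exact: wo_le_refl.
Qed.

Lemma wo_le_trans : transitive wo_le.
Proof.
move=> y x z xy yz.
have [|t] := @wo_le_min [set t | t = x \/ t = y \/ t = z].
  by exists x; left.
move=> [->|[->|->]] tmin.
- by apply: tmin; right; right.
- by rewrite (@wo_le_anti x y) // xy tmin //; left.
- suff <- : y = z by [].
  by apply: wo_le_anti; rewrite yz tmin //; right; left.
Qed.

Definition omega1 : Type :=
  {x : set nat | `[< countable [set y | wo_le y x] >]}.

HB.instance Definition _ := gen_eqMixin omega1.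
HB.instance Definition _ := gen_choiceMixin omega1.

Definition omega1_le (x y : omega1) : bool := wo_le (sval x) (sval y).

Lemma omega1_le_refl : reflexive omega1_le.
Proof. by move=> x; exact: wo_le_refl. Qed.

Lemma omega1_le_anti : antisymmetric omega1_le.
Proof. by move=> x y xy; apply: val_inj; exact: wo_le_anti. Qed.

Lemma omega1_le_trans : transitive omega1_le.
Proof. by move=> y x z; exact: wo_le_trans. Qed.

Lemma omega1_le_total : total omega1_le.
Proof. by move=> x y; exact: wo_le_total. Qed.

Fact omega1_display : Order.disp_t. Proof. exact: Order.default_display. Qed.

HB.instance Definition _ := Order.Le_isPOrder.Build omega1_display omega1
  omega1_le_refl omega1_le_anti omega1_le_trans.
HB.instance Definition _ :=
  Order.POrder_isTotal.Build omega1_display omega1 omega1_le_total.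

Lemma omega1_min (P : set omega1) : P !=set0 -> exists x, P x /\ lbound P x.
Proof.
move=> [x Px].
have [|z [y Py <-] ymin] := @wo_le_min (@sval _ _ @` P).
  by exists (sval x); exists x.
exists y; split=> // t Pt; apply: (ymin (sval t)).
by exists t.
Qed.

Lemma omega1_wo : well_founded (fun x y : omega1 => x < y).
Proof.
move=> x; apply: contrapT => nx.
have [|y [ny ymin]] := @omega1_min [set y | ~ Acc (fun x y : omega1 => x < y) y].
  by exists x.
apply: ny; constructor=> z zy; apply: contrapT => /ymin.
by rewrite leNgt zy.
Qed.

Lemma omega1_countable_seg (x : omega1) : countable [set y | y <= x].
Proof.
have /countable_injP[f finj] : countable [set y | wo_le y (sval x)].
  by case: x => x /= /asboolP.
apply/countable_injP; exists (f \o sval) => y z; rewrite !inE => yx zx /= /finj.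
by rewrite !inE => /(_ yx zx)/val_inj.
Qed.

Lemma set_nat_uncountable : ~ countable [set: set nat].
Proof.
move=> /countable_injP[f finj].
pose D := [set n | exists2 X : set nat, f X = n & ~ X n].
have [DD|nDD] := pselect (D (f D)); last by apply: (nDD); exists D.
by case: (DD) => X /finj; rewrite !inE => /(_ I I) ->.
Qed.

Lemma omega1_uncountable : ~ countable [set: omega1].
Proof.
set C := [set x | countable [set y | wo_le y x]].
move=> /countable_injP[f finj].
have cC : countable C.
  apply/countable_injP.
  exists (fun x => if pselect (C x) is left h
                   then f (exist _ x (asboolT h)) else 0%N) => x y.
  rewrite !inE => Cx Cy; case: pselect => // hx; case: pselect => // hy.
  by move=> /finj; rewrite !inE => /(_ I I) [].
apply: set_nat_uncountable.
have [/wo_le_min[x xP xmin]|nC] := pselect (~` C !=set0); last first.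
  by have <- : C = setT by apply/seteqP; split=> // x _; apply: contrapT => h;
    apply: nC; exists x.
exfalso; apply: xP; have cCx : countable (C `|` [set x]).
  rewrite -bigcup2E; apply: bigcup_countable => //.
  by case=> [|[|n]] _ //=; exact: countable1.
apply: sub_countable cCx; apply: subset_card_le => y /= yx.
have [Cy|/xmin xy] := pselect (C y); first by left.
by right; apply: wo_le_anti; rewrite yx.
Qed.

Lemma omega1_inh : [set: omega1] !=set0.
Proof.
apply/set0P/negP => /eqP h; apply: omega1_uncountable; rewrite h; exact: countable0.
Qed.

Lemma omega1_nomax (x : omega1) : [set y | x < y] !=set0.
Proof.
apply/set0P/negP => /eqP h; apply: omega1_uncountable.
apply: sub_countable (omega1_countable_seg x); apply: subset_card_le => y _ /=.
by rewrite leNgt; apply/negP => xy; have : set0 y by rewrite -h.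
Qed.

Definition ozero : omega1 := sval (cid (omega1_min omega1_inh)).

Definition osucc (x : omega1) : omega1 :=
  sval (cid (omega1_min (omega1_nomax x))).

Definition is_olimit (x : omega1) : Prop :=
  x <> ozero /\ forall z, x <> osucc z.

Lemma ozero_le (x : omega1) : ozero <= x.
Proof. by rewrite /ozero; case: cid => z /= [_]; exact. Qed.

Lemma osucc_gt (x : omega1) : x < osucc x.
Proof. by rewrite /osucc; case: cid => z /= []. Qed.

Lemma osucc_le (x y : omega1) : x < y -> osucc x <= y.
Proof. by rewrite /osucc; case: cid => z /= [_ zmin] /zmin. Qed.

Lemma osucc_inj : injective osucc.
Proof.
move=> x y xy; apply: le_anti; rewrite !leNgt; apply/andP; split; apply/negP.
- by move=> /osucc_le; rewrite -xy leNgt osucc_gt.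
- by move=> /osucc_le; rewrite xy leNgt osucc_gt.
Qed.

(* Infinite sets are [set nat], finite sets are [{fset nat}].  The natural
   numbers of the statement start at 1 and form [posN]. *)

Definition posN : set nat := [set n | (0 < n)%N].

(* [infsub M] stands for $[M]$ and [finsub M] for $[M]^{<\omega}$. *)
Definition infsub (M : set nat) : set (set nat) :=
  [set L | L `<=` M /\ infinite_set L].

Definition finsub (M : set nat) : set {fset nat} :=
  [set s | [set` s] `<=` M].

Definition fset_lt (s t : {fset nat}) : Prop :=
  forall x y, x \in s -> y \in t -> (x < y)%N.

Definition downset (F : set {fset nat}) : set {fset nat} :=
  [set s | exists2 t, F t & (s `<=` t)%fset].

Definition above (M : set nat) (m : nat) : set nat := M `&` [set n | (m < n)%N].

Definition fiber (M : set nat) (F : set {fset nat}) (m : nat) :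
    set {fset nat} :=
  [set s | [/\ finsub M s, F ([fset m] `|` s)%fset & fset_lt [fset m]%fset s]].

(* "Increasing" is read as nondecreasing, which includes the strict reading. *)
Inductive uniform : omega1 -> set nat -> set {fset nat} -> Prop :=
| uniform_zero M F : F = [set fset0] -> uniform ozero M F
| uniform_succ zeta M F :
    ~ F fset0 ->
    (forall m, M m -> uniform zeta (above M m) (fiber M F m)) ->
    uniform (osucc zeta) M F
| uniform_lim xi M F (xi_ : nat -> omega1) :
    is_olimit xi ->
    ~ F fset0 ->
    (forall m n, M m -> M n -> (m < n)%N -> xi_ m <= xi_ n) ->
    (forall m, M m -> xi_ m < xi) ->
    supremums (xi_ @` M) xi ->
    (forall m, M m -> uniform (xi_ m) (above M m) (fiber M F m)) ->
    uniform xi M F.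

(* [cantor_space] is [nat -> bool] with the product (pointwise) topology. *)
Definition chi (A : {fset nat}) : cantor_space := fun n => n \in A.

Definition cluster_point (F : set {fset nat}) (A : {fset nat}) : Prop :=
  limit_point (chi @` F) (chi A).

Definition frestrict (F : set {fset nat}) (M : set nat) : set {fset nat} :=
  F `&` finsub M.

Definition sderiv (M : set nat) (F : set {fset nat}) : set {fset nat} :=
  [set A | frestrict F M A /\
    forall L, infsub M L -> cluster_point (frestrict F ([set` A] `|` L)) A].

Definition sCB_step (M : set nat) (F : set {fset nat}) (xi : omega1)
    (rec : forall b : omega1, b < xi -> set {fset nat}) : set {fset nat} :=
  [set A | [\/ xi = ozero /\ frestrict F M A,
               exists zeta (h : zeta < xi),
                 xi = osucc zeta /\ sderiv M (rec zeta h) A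
             | is_olimit xi /\ forall b (h : b < xi), rec b h A]].

(* The xi-th strong derivative of F on M; see [sCB0], [sCBS], [sCBlim]. *)
Definition sCB (M : set nat) (F : set {fset nat}) : omega1 -> set {fset nat} :=
  Fix omega1_wo (fun=> set {fset nat}) (sCB_step M F).

Lemma sCBE M F xi : sCB M F xi = sCB_step M F (fun b (_ : b < xi) => sCB M F b).
Proof.
rewrite /sCB Fix_eq // => x f g fg; congr sCB_step.
by apply: functional_extensionality_dep => b; apply: functional_extensionality_dep.
Qed.

Lemma ozero_nsucc z : ozero <> osucc z.
Proof. by move=> h; have := ozero_le z; rewrite h leNgt osucc_gt. Qed.

Lemma sCB0 M F : sCB M F ozero = frestrict F M.
Proof.
rewrite sCBE; apply/seteqP; split=> A /=; last by move=> ?; exact: Or31.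
by case=> [[]//|[z [_ [/ozero_nsucc//]]]|[[]//]].
Qed.

Lemma sCBS M F xi : sCB M F (osucc xi) = sderiv M (sCB M F xi).
Proof.
rewrite sCBE; apply/seteqP; split=> A /=.
  case=> [[/esym/ozero_nsucc//]|[z [_ [/osucc_inj <-//]]]|[[_ /(_ xi)//]]].
by move=> h; apply: Or32; exists xi, (osucc_gt xi).
Qed.

Lemma sCBlim M F xi : is_olimit xi ->
  sCB M F xi = \bigcap_(b in [set b | b < xi]) sCB M F b.
Proof.
move=> lxi; rewrite sCBE; apply/seteqP; split=> A /=.
  case=> [[x0]|[z [_ [xz]]]|[_ h]]; last by move=> b /= /h.
  - by case: lxi.
  - by case: lxi => _ /(_ z).
by move=> h; apply: Or33; split=> // b bx; exact: h.
Qed.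

(* The default value [ozero] is returned only when no derivative is empty. *)
Definition sindex (M : set nat) (F : set {fset nat}) : omega1 :=
  xget ozero [set xi | sCB M F xi = set0 /\
                       lbound [set eta | sCB M F eta = set0] xi].

(* Main.v *)
Require Import Defs.
From HB Require Import structures.
From mathcomp Require Import all_boot all_order finmap.
From mathcomp Require Import all_classical.
From mathcomp Require Import topology cantor.
Set Implicit Arguments.
Unset Strict Implicit.
Unset Printing Implicit Defensive.
Import Order.TTheory.
Local Open Scope classical_set_scope.
Local Open Scope order_scope.

(** Write [G] for the downward closure of the [xi]-uniform family [F], and
    [G^eta] for its [eta]-th strong derivative on [L].  The theorem follows
    from two estimates, and the value of the index is read off from them.

    Lower bound ([fset0_in_sCB]): the empty set belongs to [G^eta] for every
    [eta <= xi].  By induction on [xi], the empty set survives in the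
    derivatives of each fiber [F(m)] up to the rank of [F(m)].  Putting [m] back
    in front of all sets of the fiber can only make derivatives larger
    ([sCB_fiber]), so the singleton [{m}] survives in [G] up to the rank of
    [F(m)].  Every [eta < xi] is at most that rank for almost all [m], and
    singletons [{m}] converge to the empty set, which therefore survives one
    step more.

    Upper bound ([notin_sCB]): no nonempty set belongs to [G^xi].  A set [t] of
    [F] carries a strictly decreasing sequence of ordinals starting at [xi]: the
    ranks of the iterated fibers of [F] along the initial segments of [t]
    ([uniform_rank_function]).  A set [A] of [G], with all its elements below
    [k], may be a subset of several sets [t] of [F], which may also have points
    between those of [A]; but only finitely many initial segments
    [trunc k t] arise, and the largest rank among them bounds the survival of
    [A].  Indeed, a set [B] witnessing that [A] is a cluster point contains [A]
    and has a further element beyond [k]; every [t] in [F] above [B] is one of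
    those above [A], and passing that element makes its rank drop.  If [A] is
    nonempty, the rank has already dropped below [xi] along [A]. *)

(** * Cluster points, infinite sets and ordinals *)

(** This is the only point where the product topology enters: cylinders are
    neighborhoods because projections are continuous, and conversely sets that
    agree with [A] on longer and longer initial intervals converge to [A]. *)
Lemma cluster_pointP (F : set {fset nat}) (A : {fset nat}) :
  cluster_point F A <->
  forall n, exists2 B, F B & B <> A /\ forall x, (x < n)%N -> (x \in B) = (x \in A).
Proof.
split=> [cA n|FA].
  have : nbhs (chi A) [set f : cantor_space | forall x, (x < n)%N -> f x = chi A x].
    elim: n => [|n IHn]; first by apply: filterS filterT => f _ x.
    have px : nbhs (chi A) (proj n @^-1` [set chi A n] : set cantor_space).
      by apply: (@proj_continuous _ (fun=> bool) n (chi A)); exact: discrete_set1.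
    apply: filterS (filterI IHn px) => f [fA fn] x.
    by rewrite ltnS leq_eqVlt => /orP[/eqP ->|/fA].
  move=> /cA[f [fA [B FB fB] BA]]; exists B => //; split=> [eBA|x xn].
    by case/eqP: fA; rewrite -fB eBA.
  by rewrite -[LHS]/(chi B x) fB BA.
have /choice[B BP] : forall n, exists B,
    F B /\ (B <> A /\ forall x, (x < n)%N -> (x \in B) = (x \in A)).
  by move=> n; have [B] := FA n; exists B.
have chiB : (fun n => chi (B n)) @ \oo --> chi A.
  apply/cvg_sup => x; apply/cvg_image.
    by apply/seteqP; split => // b _; exists (fun=> b).
  move=> U /nbhs_singleton UA; exists (proj x @^-1` U).
    exists x.+1 => // n /= xn; have [_ [_ BA]] := BP n.
    by rewrite /proj /chi BA.
  by apply/seteqP; split=> [_ [f fU <-]//|b Ub]; exists (fun=> b).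
move=> U /chiB[n _ nU]; have [FB [BA _]] := BP n.
exists (chi (B n)); split; last exact: nU n (leqnn n).
- apply/eqP => h; apply: BA; apply/fsetP => x.
  exact: (congr1 (@^~ x) h).
- by exists (B n).
Qed.

Lemma infinite_above (M : set nat) (n : nat) :
  infinite_set M -> infinite_set (above M n).
Proof.
move=> Minf.
suff -> : above M n = setD M [set x | (x <= n)%N].
  by apply: infinite_setD => //; exact: (finite_II n.+1).
apply/seteqP; split=> x [Mx].
- by rewrite /= ltnNge => /negP; split.
- by move=> /negP; rewrite -ltnNge; split.
Qed.

Lemma infsub_above (M L : set nat) (n : nat) :
  infsub M L -> infsub (above M n) (above L n).
Proof.
move=> [LM Linf]; split; last exact: infinite_above.
by move=> x [/LM Mx nx]; split.
Qed.

Lemma osucc_cases (x : omega1) :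
  [\/ x = ozero, exists z, x = osucc z | is_olimit x].
Proof.
have [->|x0] := pselect (x = ozero); first exact: Or31.
have [xS|xS] := pselect (exists z, x = osucc z); first exact: Or32.
by apply: Or33; split=> // z xz; apply: xS; exists z.
Qed.

Lemma lt_osucc (x y : omega1) : (x < osucc y) = (x <= y).
Proof.
apply/idP/idP => [|xy]; last exact: le_lt_trans (osucc_gt y).
by rewrite leNgt => xy; apply/negP => /osucc_le; rewrite leNgt xy.
Qed.

Lemma olimit_osucc (x y : omega1) : is_olimit x -> y < x -> osucc y < x.
Proof.
move=> [_ xS] yx; rewrite lt_neqAle osucc_le// andbT.
by apply/eqP => /esym/xS.
Qed.

(** * Uniform families *)

(** A common form for the successor and the limit clause.  Beyond [rk m < xi],
    all that matters in either case is that the ranks of the fibers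
    eventually reach each ordinal below [xi]: in the limit case they are
    nondecreasing with supremum [xi]. *)
Lemma uniform_cases xi (M : set nat) (F : set {fset nat}) : uniform xi M F ->
  xi = ozero /\ F = [set fset0] \/
  ~ F fset0 /\ exists rk : nat -> omega1,
    [/\ forall m, M m -> rk m < xi,
        forall m, M m -> uniform (rk m) (above M m) (fiber M F m) &
        forall eta, eta < xi ->
          exists n, forall m, M m -> (n <= m)%N -> eta <= rk m].
Proof.
case=> {xi F M}.
- by move=> M F ->; left.
- move=> zeta M F F0 Fu; right; split=> //; exists (fun=> zeta); split=> //.
    by move=> m _; exact: osucc_gt.
  by move=> eta; rewrite lt_osucc => etaz; exists 0%N.
- move=> xi M F rk xilim F0 rkm rklt rksup Fu; right; split=> //.
  exists rk; split=> // eta etaxi; apply: contrapT => nn.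
  case: rksup => _ /(_ eta); suff h : ubound (rk @` M) eta.
    by move=> /(_ h); rewrite leNgt etaxi.
  move=> _ [n Mn <-]; rewrite leNgt; apply/negP => etan; apply: nn.
  exists n => m Mm; rewrite leq_eqVlt => /orP[/eqP <-|nm]; first exact: ltW.
  by apply: le_trans (ltW etan) _; exact: rkm.
Qed.

(** * The empty set survives *)

(** The map [A |-> m |` A] sends the downward closure of the fiber at [m] into
    that of [F], is injective on sets above [m], and preserves convergence,
    hence it carries derivatives into derivatives.  The test sets [L'] of the
    derivative on [L] are cut down to their part above [m]. *)
Lemma sCB_fiber (L M : set nat) (F : set {fset nat}) (m : nat) eta A :
  L m -> sCB (above L m) (downset (fiber M F m)) eta A ->
  sCB L (downset F) eta (m |` A)%fset.
Proof.
move=> Lm; elim/(well_founded_induction omega1_wo): eta A => eta IH A.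
have finL B : finsub (above L m) B -> finsub L (m |` B)%fset.
  by move=> BL x /=; rewrite !inE => /orP[/eqP ->//|/BL[]].
have [->|[z ez]|etal] := osucc_cases eta.
- rewrite !sCB0 => -[[t [_ Ft _] At] AL].
  by split; [exists (m |` t)%fset => //; exact: fsetUS|exact: finL].
- rewrite ez !sCBS => -[[Az AL] clA].
  have zeta : z < eta by rewrite ez osucc_gt.
  split; first by split; [exact: IH Az|exact: finL].
  move=> L' L'sub; apply/cluster_pointP => n; have [L'L _] := L'sub.
  have /cluster_pointP/(_ n)[B [Bz BL'] [BA BAn]] :=
    clA _ (infsub_above m L'sub).
  have BL : finsub (above L m) B.
    by move=> x /BL'[/AL//|[/L'L Lx mx]]; split.
  have notin C : finsub (above L m) C -> m \notin C.
    by move=> CL; apply/negP => /CL[_]; rewrite /= ltnn.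
  exists (m |` B)%fset; last split.
  + split; first exact: IH Bz.
    move=> x /=; rewrite !inE => /orP[/eqP ->|].
      by left; rewrite eqxx.
    by move=> /BL'[xA|[]]; [left; rewrite xA orbT|right].
  + move=> eBA; apply: BA; apply/fsetP => x.
    move/fsetP/(_ x): eBA; rewrite !inE; have [->|//] := eqVneq x m.
    by rewrite (negPf (notin _ BL)) (negPf (notin _ AL)).
  + by move=> x xn; rewrite !inE BAn.
- by rewrite !sCBlim// => hA b /= beta; apply: IH => //; exact: hA.
Qed.

Lemma uniform_nonempty xi (M : set nat) (F : set {fset nat}) :
  infinite_set M -> uniform xi M F -> F !=set0.
Proof.
elim/(well_founded_induction omega1_wo): xi M F => xi IH M F Minf Fu.
have [[_ ->]|[_ [rk [rklt Fm _]]]] := uniform_cases Fu; first by exists fset0.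
have [m Mm] := infinite_setN0 Minf.
have [s [_ Fs _]] := IH _ (rklt m Mm) _ _ (infinite_above (n := m) Minf) (Fm m Mm).
by eexists; exact: Fs.
Qed.

Lemma fset0_in_sCB xi (M : set nat) (F : set {fset nat}) (L : set nat) eta :
  infinite_set M -> uniform xi M F -> infsub M L -> eta <= xi ->
  sCB L (downset F) eta fset0.
Proof.
elim/(well_founded_induction omega1_wo): xi M F L eta.
move=> xi IHxi M F L eta Minf Fu LMsub; have [LM Linf] := LMsub.
have [t Ft] := uniform_nonempty Minf Fu.
elim/(well_founded_induction omega1_wo): eta => eta IH etaxi.
have [->|[z ez]|etal] := osucc_cases eta.
- by rewrite sCB0; split; [exists t|move=> x].
- have zeta : z < eta by rewrite ez osucc_gt.
  have zxi := lt_le_trans zeta etaxi.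
  have [[xi0 _]|[_ [rk [rklt Fm rkcof]]]] := uniform_cases Fu.
    by move: zxi; rewrite xi0 ltNge ozero_le.
  have [n0 n0P] := rkcof _ zxi.
  rewrite ez sCBS; split; first by split=> [|x //]; exact: IH (ltW zxi).
  move=> L' [L'L L'inf]; apply/cluster_pointP => n.
  have [m [L'm]] := infinite_setN0 (infinite_above (n := maxn n n0) L'inf).
  rewrite /= gtn_max => /andP[nm n0m].
  have Lm := L'L _ L'm; have Mm := LM _ Lm.
  exists [fset m]%fset; last split.
  + split; last by move=> x /=; rewrite !inE => /eqP ->; right.
    rewrite -[[fset m]%fset]fsetU0; apply: (@sCB_fiber _ M) => //.
    apply: IHxi (rklt m Mm) _ _ _ _ _ (Fm m Mm) _ _.
    * exact: infinite_above.
    * exact: infsub_above.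
    * exact/n0P/ltnW.
  + by move/fsetP/(_ m); rewrite !inE eqxx.
  + by move=> x xn; rewrite !inE ltn_eqF// (ltn_trans xn).
- by rewrite sCBlim// => b /= beta; apply: IH => //; exact/ltW/(lt_le_trans beta).
Qed.

(** * Ranks along the sets of a uniform family *)

Definition trunc (k : nat) (t : {fset nat}) : {fset nat} :=
  [fset x in t | (x < k)%N]%fset.

Lemma in_trunc k t x : (x \in trunc k t) = (x \in t) && (x < k)%N.
Proof. by rewrite !inE. Qed.

Lemma trunc0 t : trunc 0 t = fset0.
Proof. by apply/fsetP => x; rewrite in_trunc ltn0 andbF. Qed.

Definition fset_min (t : {fset nat}) : nat :=
  xget 0%N [set m | m \in t /\ forall x, x \in t -> (m <= x)%N].

Lemma fset_minP (t : {fset nat}) : t <> fset0 ->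
  fset_min t \in t /\ forall x, x \in t -> (fset_min t <= x)%N.
Proof.
move=> t0; have tex : exists m, m \in t by apply/fset0Pn/eqP.
have [m mt mmin] := ex_minnP tex.
by rewrite /fset_min; case: xgetP => [y _ //|/(_ m)[]].
Qed.

Lemma fset_min_eq (t : {fset nat}) m :
  m \in t -> (forall x, x \in t -> (m <= x)%N) -> fset_min t = m.
Proof.
move=> mt mmin; apply: xget_unique => // y [yt ymin].
by apply/eqP; rewrite eqn_leq mmin// ymin.
Qed.

(** [r u] plays the role of the rank of the iterated fiber [F(u)], for [u] an
    initial segment of a set in [F].  Segments are cut at arbitrary integers,
    so that a segment strictly grows from [k] to [l] exactly when [t] has
    an element [x] in between. *)
Definition rank_function (xi : omega1) (F : set {fset nat})
    (r : {fset nat} -> omega1) : Prop :=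
  r fset0 = xi /\
  forall t x k l, F t -> x \in t -> (k <= x < l)%N ->
    r (trunc l t) < r (trunc k t).

(** The rank of [F(u)] is the rank of [F(m)(u \ m)] for [m] the smallest element
    of [u], so rank functions of the fibers at all [m] can be glued. *)
Lemma uniform_rank_function xi (M : set nat) (F : set {fset nat}) :
  F `<=` finsub M -> uniform xi M F -> exists r, rank_function xi F r.
Proof.
elim/(well_founded_induction omega1_wo): xi M F => xi IH M F FM Fu.
have [[xi0 F0]|[F0 [rk [rklt Fm _]]]] := uniform_cases Fu.
  by exists (fun=> xi); split=> // t x k l; rewrite F0 => ->.
have /choice[r rP] m : exists r, M m -> rank_function (rk m) (fiber M F m) r.
  have [Mm|nMm] := pselect (M m); last by exists (fun=> xi).
  have [|r rr] := IH _ (rklt m Mm) _ _ _ (Fm m Mm).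
    move=> s [sM _ ms] x xs; split; first exact: sM.
    by apply: ms => //; rewrite !inE.
  by exists r.
exists (fun u => if u == fset0 then xi
                 else r (fset_min u) (u `\ fset_min u)%fset).
split=> [|t x k l Ft xt /andP[kx xl]]; first by rewrite eqxx.
have [|mt tm] := @fset_minP t; first by move=> t0; apply: F0; rewrite -t0.
set m := fset_min t in mt tm.
have Mm : M m by exact: FM Ft _ mt.
have [rm0 rmlt] := rP m Mm.
pose s := (t `\ m)%fset.
have Fs : fiber M F m s.
  split.
  - by move=> y /=; rewrite !inE => /andP[_ /(FM _ Ft)].
  - by rewrite [X in F X](fsetD1K mt).
  - move=> y z; rewrite !inE => /eqP -> /andP[zm zt].
    by rewrite ltn_neqAle eq_sym zm tm.
(* Beyond [m], truncation commutes with the removal of the smallest element. *)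
have rE j : (m < j)%N -> trunc j t != fset0 /\
    r (fset_min (trunc j t)) (trunc j t `\ fset_min (trunc j t))%fset =
    r m (trunc j s).
  move=> mj; have mtr : m \in trunc j t by rewrite in_trunc mt.
  split; first by apply/fset0Pn; exists m.
  have -> : fset_min (trunc j t) = m.
    by apply: fset_min_eq => // y; rewrite in_trunc => /andP[/tm].
  congr (r m _); apply/fsetP => y.
  by rewrite in_fsetD1 !in_trunc in_fsetD1 andbA.
have rle j : r m (trunc j s) <= rk m.
  have [->|/fset0Pn[y]] := eqVneq (trunc j s) fset0; first by rewrite rm0.
  rewrite in_trunc => /andP[ys yj]; rewrite -rm0 -(trunc0 s) ltW//.
  exact: rmlt ys _.
have [/negPf -> ->] := rE l (leq_ltn_trans (tm _ xt) xl).
(* If [k <= m], the drop is the one from [xi] to the rank of [F(m)];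
   otherwise it takes place inside the fiber at [m], where [x] still lies. *)
have [km|mk] := leqP k m.
  suff -> : trunc k t = fset0.
    by rewrite eqxx; exact: le_lt_trans (rle l) (rklt m Mm).
  apply/fsetP => y; rewrite in_trunc inE; apply/negP => /andP[/tm my yk].
  by move: (leq_trans yk km); rewrite ltnNge my.
have [/negPf -> ->] := rE k mk.
apply: (rmlt s x) => //; last by rewrite kx.
by rewrite in_fsetD1 xt andbT; apply: contraTneq mk => <-; rewrite -leqNgt.
Qed.

(** * Nonempty sets do not survive *)

(** Finitely many ordinals below a limit ordinal are bounded away from it. *)
Lemma olimit_bound (eta : omega1) (s : seq omega1) : is_olimit eta ->
  exists2 b, b < eta & forall x, x \in s -> x < eta -> x < b.
Proof.
move=> etal; elim: s => [|y s [b beta bP]].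
  exists ozero => //; rewrite lt_neqAle ozero_le andbT.
  by apply/eqP => h; case: etal => /(_ (esym h)).
have [yeta|yeta] := ltP y eta; last first.
  by exists b => // x; rewrite inE => /orP[/eqP ->|/bP //]; rewrite ltNge yeta.
exists (Order.max b (osucc y)); first by rewrite gt_max beta olimit_osucc.
move=> x; rewrite inE lt_max => /orP[/eqP ->|/bP xb /xb -> //].
by rewrite osucc_gt orbT.
Qed.

(** If the ranks at [k] of the sets in [F] above [A] are all less than [eta],
    then [A] has left the derivatives at stage [eta].  The hypothesis on [A] is
    strict at every single [t], without a common bound: at successor
    stages strictness is what the drop of ranks reproduces, and at limit
    stages a common bound exists since there are only finitely many segments
    [trunc k t]. *)
Lemma notin_sCB xi (F : set {fset nat}) r (L : set nat) eta A k :
  rank_function xi F r -> infinite_set L -> (forall x, x \in A -> (x < k)%N) ->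
  (forall t, F t -> (A `<=` t)%fset -> r (trunc k t) < eta) ->
  ~ sCB L (downset F) eta A.
Proof.
move=> [_ rlt] Linf.
elim/(well_founded_induction omega1_wo): eta A k => eta IH A k Ak Aeta.
have [eta0|[z ez]|etal] := osucc_cases eta.
- rewrite eta0 sCB0 => -[[t Ft At] _].
  by have := Aeta t Ft At; rewrite eta0 ltNge ozero_le.
- rewrite ez sCBS => -[_ /(_ L) clA].
  have /cluster_pointP/(_ k)[B [Bz _] [BA BAk]] :=
    clA (conj (@subset_refl _ L) Linf).
  have AB : (A `<=` B)%fset by apply/fsubsetP => y yA; rewrite BAk// Ak.
  have [x xB xA] : exists2 x, x \in B & x \notin A.
    apply/fsubsetPn/negP => BsubA; apply: BA.
    by apply/eqP; rewrite eqEfsubset BsubA.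
  (* [B] agrees with [A] below [k], so the new element lies beyond [k]. *)
  have kx : (k <= x)%N by rewrite leqNgt; apply: contra xA => /BAk <-.
  pose l := (\max_(y <- B) y).+1.
  have Bl y : y \in B -> (y < l)%N by move=> yB; rewrite ltnS leq_bigmax_seq.
  have zeta : z < eta by rewrite ez osucc_gt.
  apply: (IH z zeta B l Bl _ Bz) => t Ft Bt.
  have := Aeta t Ft (fsubset_trans AB Bt).
  (* Passing [x] brings the rank from at most [z] to strictly less than [z]. *)
  rewrite ez lt_osucc; apply: lt_le_trans; apply: (rlt t x) => //.
    exact: (fsubsetP Bt).
  by rewrite kx Bl.
- rewrite sCBlim// => hA.
  (* Every segment [trunc k t] is a subset of the interval of integers below [k]. *)
  pose s := [seq r u | u <- fpowerset [fset y in iota 0 k]%fset].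
  have [b beta bP] := olimit_bound s etal.
  apply: (IH b beta A k Ak) (hA b beta) => t Ft At.
  apply: bP (Aeta t Ft At); apply: map_f; rewrite fpowersetE.
  by apply/fsubsetP => y; rewrite in_trunc !inE mem_iota => /andP[].
Qed.

Theorem theorem1p18 (xi : omega1) (M : set nat) (F : set {fset nat})
    (M_inf : infsub posN M) (F_sub : F `<=` finsub M)
    (F_unif : uniform xi M F) (L : set nat) (L_inf : infsub M L) :
  sCB L (downset F) xi = [set fset0] /\ sindex L (downset F) = osucc xi.
Proof.
have [_ Minf] := M_inf; have [_ Linf] := L_inf.
have sCBxi : sCB L (downset F) xi = [set fset0].
  apply/seteqP; split=> [A|_ ->]; last exact: fset0_in_sCB L_inf (lexx xi).
  move=> hA /=; apply: contrapT => /eqP/fset0Pn[x xA].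
  have [r rF] := uniform_rank_function F_sub F_unif; have [r0 rlt] := rF.
  pose k := (\max_(y <- A) y).+1.
  have Ak y : y \in A -> (y < k)%N.
    by move=> yA; rewrite ltnS; exact: leq_bigmax_seq.
  apply: (notin_sCB rF Linf Ak) hA => t Ft At.
  (* The rank starts at [xi] and drops when [x], an element of [A], is passed. *)
  rewrite -[X in _ < X]r0 -(trunc0 t); apply: (rlt t x) => //.
    exact: (fsubsetP At).
  by rewrite /= Ak.
have sCBS0 : sCB L (downset F) (osucc xi) = set0.
  rewrite sCBS sCBxi; apply/seteqP; split=> // A [[A0 _] /(_ L) clA].
  have /cluster_pointP/(_ 0%N)[B [B0 _] [BA _]] :=
    clA (conj (@subset_refl _ L) Linf).
  by apply: BA; rewrite B0 A0.
have minS : lbound [set eta | sCB L (downset F) eta = set0] (osucc xi).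
  move=> eta etaempty; apply: osucc_le; rewrite ltNge; apply/negP => etaxi.
  have : sCB L (downset F) eta fset0 by exact: fset0_in_sCB L_inf etaxi.
  by rewrite etaempty.
split=> //; apply: xget_unique => // eta [etaempty etamin].
by apply: le_anti; rewrite minS// etamin.
Qed.
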